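(* Let $\alpha_0,\alpha_1\in\mathbb{C}$ with $\alpha_0+\alpha_1=0$, and let $K_1,K_2,K_3\in\mathbb{C}[q_1,p_1,q_2,p_2]$ be the polynomials given in the context. Then $$\{K_1,K_2\}=\{K_1,K_3\}=\{K_2,K_3\}=0,$$ where $$\{K_i,K_j\}=\frac{\partial K_i}{\partial p_1}\frac{\partial K_j}{\partial q_1}-\frac{\partial K_i}{\partial q_1}\frac{\partial K_j}{\partial p_1}+\frac{\partial K_i}{\partial p_2}\frac{\partial K_j}{\partial q_2}-\frac{\partial K_i}{\partial q_2}\frac{\partial K_j}{\partial p_2}.$$
   Context: The polynomials are $$K_1=q_1p_1^2+q_1^2-\alpha_0p_1+\tfrac14q_2^2-\tfrac14p_2^2+p_1q_2p_2,$$ $$K_2=q_2^2p_2^2-\tfrac14q_2^2+\tfrac14p_2^2-2\alpha_0q_2p_2+q_1q_2^2+q_1p_2^2-p_1q_2p_2+p_1^2q_2^2,$$ $$\begin{aligned}K_3=&\tfrac12q_1^2p_1^4+q_1^3p_1^2+\tfrac12q_1^4-\alpha_0q_1p_1^3+\alpha_1q_1^2p_1+\tfrac12\alpha_0^2p_1^2+\tfrac1{32}q_2^4+\tfrac1{32}p_2^4-\tfrac1{16}q_2^2p_2^2+q_1p_1^3q_2p_2\\&+\tfrac12p_1^2q_2^2p_2^2-\tfrac14q_1p_1^2p_2^2-\tfrac14p_1q_2p_2^3+q_1^2p_1q_2p_2+\tfrac14q_1p_1^2q_2^2+\tfrac14p_1q_2^3p_2-\alpha_0p_1^2q_2p_2\\&+\tfrac14\alpha_0p_1p_2^2+\tfrac14\alpha_1p_1q_2^2+\tfrac14q_1^2q_2^2-\tfrac14q_1^2p_2^2.\end{aligned}$$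 *)

(* Defs.v *)
From mathcomp Require Import all_boot all_order all_algebra.
From mathcomp Require Import complex mpoly.

Set Implicit Arguments.
Unset Strict Implicit.
Unset Printing Implicit Defensive.

Import GRing.Theory.
Local Open Scope ring_scope.

(* The variables of {mpoly C[4]} are taken in the order q1, p1, q2, p2. *)
Definition iq1 : 'I_4 := @Ordinal 4 0 isT.
Definition ip1 : 'I_4 := @Ordinal 4 1 isT.
Definition iq2 : 'I_4 := @Ordinal 4 2 isT.
Definition ip2 : 'I_4 := @Ordinal 4 3 isT.

Section Polynomials.

Variable C : fieldType.

Local Notation q1 := ('X_iq1 : {mpoly C[4]}).
Local Notation p1 := ('X_ip1 : {mpoly C[4]}).
Local Notation q2 := ('X_iq2 : {mpoly C[4]}).
Local Notation p2 := ('X_ip2 : {mpoly C[4]}).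

Definition poisson (f g : {mpoly C[4]}) : {mpoly C[4]} :=
  f^`M(ip1) * g^`M(iq1) - f^`M(iq1) * g^`M(ip1)
  + f^`M(ip2) * g^`M(iq2) - f^`M(iq2) * g^`M(ip2).

Definition K1 (alpha0 : C) : {mpoly C[4]} :=
  q1 * p1 ^+ 2 + q1 ^+ 2 - alpha0 *: p1
  + (1 / 4) *: q2 ^+ 2 - (1 / 4) *: p2 ^+ 2 + p1 * q2 * p2.

Definition K2 (alpha0 : C) : {mpoly C[4]} :=
  q2 ^+ 2 * p2 ^+ 2 - (1 / 4) *: q2 ^+ 2 + (1 / 4) *: p2 ^+ 2
  - (2 * alpha0) *: (q2 * p2) + q1 * q2 ^+ 2 + q1 * p2 ^+ 2
  - p1 * q2 * p2 + p1 ^+ 2 * q2 ^+ 2.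

Definition K3 (alpha0 alpha1 : C) : {mpoly C[4]} :=
  (1 / 2) *: (q1 ^+ 2 * p1 ^+ 4) + q1 ^+ 3 * p1 ^+ 2 + (1 / 2) *: q1 ^+ 4
  - alpha0 *: (q1 * p1 ^+ 3) + alpha1 *: (q1 ^+ 2 * p1)
  + (1 / 2 * alpha0 ^+ 2) *: p1 ^+ 2
  + (1 / 32) *: q2 ^+ 4 + (1 / 32) *: p2 ^+ 4
  - (1 / 16) *: (q2 ^+ 2 * p2 ^+ 2) + q1 * p1 ^+ 3 * q2 * p2
  + (1 / 2) *: (p1 ^+ 2 * q2 ^+ 2 * p2 ^+ 2)
  - (1 / 4) *: (q1 * p1 ^+ 2 * p2 ^+ 2) - (1 / 4) *: (p1 * q2 * p2 ^+ 3)
  + q1 ^+ 2 * p1 * q2 * p2 + (1 / 4) *: (q1 * p1 ^+ 2 * q2 ^+ 2)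
  + (1 / 4) *: (p1 * q2 ^+ 3 * p2) - alpha0 *: (p1 ^+ 2 * q2 * p2)
  + (1 / 4 * alpha0) *: (p1 * p2 ^+ 2) + (1 / 4 * alpha1) *: (p1 * q2 ^+ 2)
  + (1 / 4) *: (q1 ^+ 2 * q2 ^+ 2) - (1 / 4) *: (q1 ^+ 2 * p2 ^+ 2).

End Polynomials.

(* Main.v *)
Require Import Defs.
From mathcomp Require Import all_boot all_order all_algebra.
From mathcomp Require Import complex mpoly.
From mathcomp Require Import reals.
From mathcomp Require Import ring.
Import GRing.Theory.
Local Open Scope ring_scope.

(** At [alpha0 + alpha1 = 0] the polynomial [K3] degenerates to [K1 ^+ 2 / 2],
    so by the Leibniz rule its brackets with [K1] and [K2] are multiples of
    [{K1, K1}] and [{K2, K1}]; only [{K1, K2} = 0] needs a computation. *)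

Lemma poissonvv (C : fieldType) (f : {mpoly C[4]}) : poisson f f = 0.
Proof. by rewrite /poisson; ring. Qed.

Lemma poissonC (C : fieldType) (f g : {mpoly C[4]}) :
  poisson f g = - poisson g f.
Proof. by rewrite /poisson; ring. Qed.

Lemma poissonZr (C : fieldType) (c : C) (f g : {mpoly C[4]}) :
  poisson f (c *: g) = c *: poisson f g.
Proof. by rewrite /poisson !mderivZ -!mul_mpolyC; ring. Qed.

Lemma poisson_sqrr (C : fieldType) (f g : {mpoly C[4]}) :
  poisson f (g ^+ 2) = 2 * g * poisson f g.
Proof. by rewrite /poisson expr2 !mderivM; ring. Qed.

(** The Boolean form lets simplification decide each derivative at concrete indices. *)
Lemma mderivXU (C : fieldType) (n : nat) (i j : 'I_n) :
  ('X_j : {mpoly C[n]})^`M(i) = (i == j)%:R.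
Proof.
rewrite mderivX mnm1E eq_sym; case: eqP => [->|_]; last by rewrite scale0r.
by rewrite -{1}[U_(j)%MM]add0m addmK scale1r mpolyX0.
Qed.

(** The [alpha1] terms of [K3] are the cross terms of [- alpha0 *: p1] with [q1 ^+ 2] and
    [q2 ^+ 2 / 4], once [alpha1 = - alpha0]. *)
Lemma K3E (C : fieldType) (alpha0 alpha1 : C) : (2 : C) != 0 ->
  alpha0 + alpha1 = 0 -> K3 alpha0 alpha1 = 2^-1 *: K1 alpha0 ^+ 2.
Proof.
move=> C2 /eqP; rewrite addrC addr_eq0 => /eqP ->.
(* All denominators are powers of 2, so each fraction becomes a power of [h], subject to [2 * h = 1]
   only. *)
pose h : {mpoly C[4]} := (2^-1)%:MP.
have h2 : 2 * h = 1 by rewrite mulr_natl -mpolyCMn -[_ *+ 2]mulr_natl mulfV.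
have hE k c : (1 / (2 ^ k)%:R * c)%:MP = h ^+ k * c%:MP :> {mpoly C[4]}.
  by rewrite natrX div1r -exprVn rmorphM rmorphXn.
have hE1 k : (1 / (2 ^ k)%:R)%:MP = h ^+ k :> {mpoly C[4]}.
  by rewrite -[1 / _]mulr1 hE rmorph1 mulr1.
rewrite /K3 /K1 -!mul_mpolyC.
rewrite !(hE 1%N) !(hE 2%N) !(hE1 1%N) !(hE1 2%N) !(hE1 4%N) !(hE1 5%N).
rewrite rmorphXn rmorphN -/h /=.
move: alpha0%:MP h h2 {hE hE1} => a h h2.
(* Isolating the factor [2 * h] of the cross terms uses up that relation; what remains is an
   identity with [h] a free variable. *)
have sqr6 (x y z u v w : {mpoly C[4]}) :
    h * (x + y + z + u + v + w) ^+ 2 =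
    h * (x ^+ 2 + y ^+ 2 + z ^+ 2 + u ^+ 2 + v ^+ 2 + w ^+ 2)
    + (2 * h) * (x * (y + z + u + v + w) + y * (z + u + v + w)
                 + z * (u + v + w) + u * (v + w) + v * w).
  by ring.
by rewrite sqr6 h2; ring.
Qed.

Lemma poissonK1K2 (C : fieldType) (alpha0 : C) : (2 : C) != 0 ->
  poisson (K1 alpha0) (K2 alpha0) = 0.
Proof.
(* Powers are unfolded into products so that the Leibniz rule and [mderivXU] suffice. *)
move=> C2; rewrite /poisson /K1 /K2 -!mul_mpolyC !exprS !expr0 !mulr1.
rewrite !(mderivD, mderivN, mderiv_mulC, mderivM, mderivXU) /=.
set c := (1 / 4)%:MP.
have c4 : 4 * c = 1.
  rewrite mulr_natl -mpolyCMn -[_ *+ 4]mulr_natl div1r mulfV //.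
  by rewrite (natrM _ 2 2) mulf_neq0.
rewrite rmorphM rmorph_nat /=; move: c c4 alpha0%:MP => c c4 a.
(* The bracket vanishes only through [4 * c = 1]; this is the cofactor of
   [4 * c - 1]. *)
transitivity ((4 * c - 1) * (a * ('X_iq2 ^+ 2 + 'X_ip2 ^+ 2)
    - 'X_iq2 * 'X_ip2 * ('X_iq2 ^+ 2 + 'X_ip2 ^+ 2 + 'X_ip1 ^+ 2 + 2 * 'X_iq1))
    : {mpoly C[4]}); last by rewrite c4 subrr mul0r.
ring.
Qed.

Theorem proposition4p3 (R : realType) (alpha0 alpha1 : R[i]) :
  alpha0 + alpha1 = 0 ->
  poisson (K1 alpha0) (K2 alpha0) = 0
  /\ poisson (K1 alpha0) (K3 alpha0 alpha1) = 0
  /\ poisson (K2 alpha0) (K3 alpha0 alpha1) = 0.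
Proof.
move=> a01; have C2 : (2 : R[i]) != 0 by rewrite Num.Theory.pnatr_eq0.
have K12 := poissonK1K2 _ alpha0 C2.
rewrite K3E // !poissonZr !poisson_sqrr poissonvv (poissonC _ (K2 _)) K12.
by rewrite oppr0 mulr0 scaler0.
Qed.
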